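(* Let $f,g:\mathbb{N}\to\mathbb{R}$ be functions with $f(n)=\omega(\log n)$ and $g(n)=\omega(\log n)$, and fix a constant $\alpha\ge 0$ ($\alpha=O(1)$). There is no algorithm which, for every $n$ and every unknown $n$-qubit pure state $|\psi\rangle$, given $O(\mathrm{poly}(n))$ copies of $|\psi\rangle$, samples from a distribution $q$ on $\{0,1\}^{2n}$ with $\|p_\psi-q\|_{\mathrm{TV}}\le 1/3$. Moreover, this remains true even if the algorithm is only required to work for states $|\psi\rangle$ promised to satisfy $M_\alpha(\psi)<g(n)$ and $\mathcal{S}_\alpha(\psi_{A:B})<f(n)$ for every bipartition $(A:B)$ of the $n$ qubits.
   Context: Pauli strings are labelled by $x=(v_1,w_1,\dots,v_n,w_n)\in\{0,1\}^{2n}$ via $P_x=i^{v\cdot w}(X^{v_1}Z^{w_1})\otimes\cdots\otimes(X^{v_n}Z^{w_n})$. For an $n$-qubit state $\rho$, the Pauli distribution is $p_\rho(x)=\frac{1}{2^n}\frac{\mathrm{tr}(\rho P_x)^2}{\mathrm{tr}(\rho^2)}$ on $\{0,1\}^{2n}$. For a distribution $p$, the Rényi entropy is $H_\alpha(p)=\frac{1}{1-\alpha}\log_2\sum_x p(x)^\alpha$ (with the limits $H_0=\log_2|\mathrm{supp}(p)|$, $H_1$ the Shannon entropy). The stabilizer entropy of a pure $n$-qubit state $\psi$ is $M_\alpha(\psi)=H_\alpha(p_\psi)-n$. For a bipartition $(A:B)$, the Rényi entanglement entropy is $\mathcal{S}_\alpha(\psi_{A:B})=\frac{1}{1-\alpha}\log_2\mathrm{tr}(\rho_A^\alpha)$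 where $\rho_A$ is the reduced state on $A$. $\|\cdot\|_{\mathrm{TV}}$ is the total variation distance. *)

(* Defs.v *)
From HB Require Import structures.
From mathcomp Require Import all_boot all_order all_algebra.
From mathcomp Require Import reals exp.
From mathcomp Require Import complex.
Set Implicit Arguments. Unset Strict Implicit. Unset Printing Implicit Defensive.
Import Order.TTheory GRing.Theory Num.Theory.
Local Open Scope ring_scope.

Section Quantum.
Variable R : realType.
Local Notation C := (R[i]).

Definition log2 (x : R) : R := ln x / ln 2.

Definition renyi_seq (a : R) (s : seq R) : R :=
  if a == 0 then log2 (count (fun p => p != 0) s)%:R
  else if a == 1 then - \sum_(p <- s | p != 0) p * log2 p
  else (1 - a)^-1 * log2 (\sum_(p <- s | p != 0) powR p a).

Definition renyi (T : finType) (a : R) (p : T -> R) : R :=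
  renyi_seq a [seq p x | x <- enum T].

Definition tv_dist (T : finType) (p q : T -> R) : R :=
  2^-1 * \sum_(x : T) `|p x - q x|.

(** Operators on the Hilbert space with orthonormal basis labelled by the
    finite type T, given by their matrix entries. *)
Definition op (T : finType) := T -> T -> C.
Definition op_mul (T : finType) (A B : op T) : op T :=
  fun a b => \sum_(c : T) A a c * B c b.
Definition op_id (T : finType) : op T := fun a b => (a == b)%:R.
Definition op_tr (T : finType) (A : op T) : C := \sum_(a : T) A a a.
Definition mx_of (T : finType) (A : op T) : 'M[C]_#|T| :=
  \matrix_(i, j) A (enum_val i) (enum_val j).
(** positive semidefinite: <v|A|v> >= 0 for all v (in C, 0 <= z means z real nonneg) *)
Definition psd (T : finType) (A : op T) : Prop :=
  forall v : T -> C, 0 <= \sum_(a : T) \sum_(b : T) conjc (v a) * A a b * v b.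

Definition qbasis (n : nat) := {ffun 'I_n -> bool}.

Definition is_pure_state (T : finType) (psi : T -> C) : Prop :=
  \sum_(a : T) psi a * conjc (psi a) = 1.
Definition density (T : finType) (psi : T -> C) : op T :=
  fun a b => psi a * conjc (psi b).

Definition pX : op bool := fun a b => (a == ~~ b)%:R.
Definition pZ : op bool := fun a b => (a == b)%:R * (-1) ^+ b.

(** Pauli labels x = (v_1,w_1,...,v_n,w_n) in {0,1}^{2n}, stored as the
    n pairs (v_j, w_j). *)
Definition plabel (n : nat) := {ffun 'I_n -> bool * bool}.

Definition pauli1 (vw : bool * bool) : op bool :=
  op_mul (if vw.1 then pX else @op_id bool) (if vw.2 then pZ else @op_id bool).

(** P_x = i^{v.w} (X^{v_1}Z^{w_1}) (x) ... (x) (X^{v_n}Z^{w_n});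
    tensor product written in the computational basis. *)
Definition pauli (n : nat) (x : plabel n) : op (qbasis n) :=
  fun a b => 'i%C ^+ (\sum_(j < n) ((x j).1 && (x j).2 : nat))%N *
             \prod_(j < n) pauli1 (x j) (a j) (b j).

Definition pauli_dist (n : nat) (rho : op (qbasis n)) (x : plabel n) : R :=
  complex.Re ((op_tr (op_mul rho (pauli x))) ^+ 2 /
      ((2 ^+ n)%:C%C * op_tr (op_mul rho rho))).

Definition stab_entropy (n : nat) (a : R) (psi : qbasis n -> C) : R :=
  renyi a (pauli_dist (density psi)) - n%:R.

(** Bipartition: A a subset of the qubits, B its complement. *)
Definition subbasis (n : nat) (A : {set 'I_n}) :=
  {ffun {i : 'I_n | i \in A} -> bool}.
Definition csubbasis (n : nat) (A : {set 'I_n}) :=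
  {ffun {i : 'I_n | i \notin A} -> bool}.

Definition join (n : nat) (A : {set 'I_n}) (a : subbasis A) (b : csubbasis A)
  : qbasis n :=
  [ffun i : 'I_n => match boolP (i \in A) with
                    | AltTrue h => a (exist _ i h)
                    | AltFalse h => b (exist _ i h)
                    end].

Definition ptrace (n : nat) (A : {set 'I_n}) (rho : op (qbasis n))
  : op (subbasis A) :=
  fun a a' => \sum_(b : csubbasis A) rho (join a b) (join a' b).

(** Rényi entanglement entropy S_alpha(psi_{A:B}) is at most / below a bound:
    S_alpha = 1/(1-alpha) log2 tr(rho_A^alpha), computed from the spectrum
    (eigenvalues with multiplicity, i.e. the roots of the characteristic
    polynomial) of rho_A, with the limiting cases alpha = 0, 1. *)
Definition is_spectrum (k : nat) (M : 'M[C]_k) (s : seq C) : Prop :=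
  char_poly M = \prod_(l <- s) ('X - l%:P).

Definition ent_entropy_lt (n : nat) (a : R) (psi : qbasis n -> C)
  (A : {set 'I_n}) (bound : R) : Prop :=
  forall s : seq C, is_spectrum (mx_of (@ptrace n A (density psi))) s ->
    renyi_seq a [seq complex.Re l | l <- s] < bound.

Definition copies_basis (m n : nat) := {ffun 'I_m -> qbasis n}.
Definition tensor_power (m n : nat) (psi : qbasis n -> C) : copies_basis m n -> C :=
  fun c => \prod_(k < m) psi (c k).

Definition is_povm (T O : finType) (E : O -> op T) : Prop :=
  (forall o, psd (E o)) /\ (forall a b, \sum_(o : O) E o a b = op_id a b).

Definition outcome_dist (T O : finType) (E : O -> op T) (Psi : T -> C) (o : O) : R :=
  complex.Re (\sum_(a : T) \sum_(b : T) conjc (Psi a) * E o a b * Psi b).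

Definition little_omega_log (f : nat -> R) : Prop :=
  forall K : R, 0 < K -> exists N : nat, forall n : nat, (N <= n)%N ->
    K * ln n%:R < f n.

Definition poly_bounded (m : nat -> nat) : Prop :=
  exists c k : nat, forall n : nat, (m n <= c * n ^ k + c)%N.

End Quantum.

Arguments tensor_power {R} m {n} psi.
Arguments ptrace {R n} A rho.
Arguments ent_entropy_lt {R n} a psi A bound.
Arguments stab_entropy {R n} a psi.
Arguments pauli_dist {R n} rho x.
Arguments is_povm {R T O} E.
Arguments outcome_dist {R T O} E Psi o.
Arguments tv_dist {R T} p q.
Arguments density {R T} psi.
Arguments is_pure_state {R T} psi.
Arguments little_omega_log {R} f.

(* Main.v *)
(* For a set T of d basis states consider the phase states
     psi_{b,s} = d^{-1/2} sum_{a in T} i^{b.a} (-1)^{s(a)} |a>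
   with s a uniformly random sign function.  The state psi_{b,s} is fixed by the
   antiunitary Z^b K (K complex conjugation), so its Pauli distribution lives on
   the strings X^v Z^w with v.w + v.b even, and it gives mass exactly 1/d to
   v = 0.  Averaged over s, the collision-free part of psi_{b,s}^{(x) m} does not
   depend on b, and the colliding part has weight at most m^2/d.  So the output
   of an m-copy measurement hardly depends on b, while a given label with v <> 0
   satisfies the parity condition for only half of the b's: on average over b
   and s it lands on the right set (with v <> 0) with probability about 1/2,
   whereas total variation error 1/3 would require about 2/3.
   Take for T the basis states supported on the first k qubits, with
   k = Theta(log n) and 2^k >> m^2: the support of the Pauli distribution has
   at most 2^(k+n) elements and reduced states have rank at most 2^k, so all
   Rényi stabilizer and entanglement entropies are at most k, below f and g. *)

Require Import Defs.
From HB Require Import structures.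
From mathcomp Require Import all_boot all_order all_algebra.
From mathcomp Require Import reals sequences exp complex.
From mathcomp Require Import zify ring lra.
Import Order.TTheory GRing.Theory Num.Theory.
Local Open Scope ring_scope.

(** * Rényi entropies and spectra *)

(** With [w = x ^ a], apply [1 + t <= exp t] to [x / w = exp ((1 - a) ln x)] and to
    [1 / w = exp (- a ln x)]. Weighting the two bounds by [a] and [1 - a] cancels the logarithm. *)
Lemma powR_le_tangent (R : realType) (a x : R) :
  0 <= a <= 1 -> 0 < x -> powR x a <= 1 + a * (x - 1).
Proof.
case/andP=> a0 a1 x0; rewrite /powR gt_eqF //.
have [w w0 Ew] : exists2 w, 0 < w & expR (a * ln x) = w.
  by exists (expR (a * ln x)) => //; exact: expR_gt0.
have Ex : x = w * expR (ln x - a * ln x).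
  by rewrite -Ew -expRD addrC subrK lnK // posrE.
have E1 : 1 = w * expR (- (a * ln x)) by rewrite -Ew -expRD subrr expR0.
have h1 : w * (1 + (ln x - a * ln x)) <= x.
  by rewrite {3}Ex ler_pM2l // expR_ge1Dx.
have h2 : w * (1 + (- (a * ln x))) <= 1.
  by rewrite {2}E1 ler_pM2l // expR_ge1Dx.
have h3 : a * (w * (1 + (ln x - a * ln x))) <= a * x by rewrite ler_wpM2l.
have h4 : (1 - a) * (w * (1 + (- (a * ln x)))) <= (1 - a) * 1.
  by rewrite ler_wpM2l // subr_ge0.
rewrite Ew; lra.
Qed.

(** This is [powR_le_tangent] for the exponent [1 / a] at the point [x ^ a]. *)
Lemma powR_ge_tangent (R : realType) (a x : R) :
  1 < a -> 0 < x -> 1 + a * (x - 1) <= powR x a.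
Proof.
move=> a1 x0; have a0 : 0 < a by apply: lt_trans a1.
have ia : 0 <= a^-1 <= 1 by rewrite invr_ge0 (ltW a0) invf_le1 // ltW.
have := powR_le_tangent _ a^-1 (powR x a) ia (powR_gt0 _ x0).
rewrite -powRrM divff ?gt_eqF // powRr1 ?(ltW x0) // => h.
have : a * x <= a * (1 + a^-1 * (powR x a - 1)) by rewrite ler_pM2l.
rewrite mulrDr mulrA divff ?gt_eqF // mul1r; lra.
Qed.

Lemma ln_le_subr1 (R : realType) (x : R) : 0 < x -> ln x <= x - 1.
Proof.
by move=> x0; have := expR_ge1Dx (ln x); rewrite lnK ?posrE //; lra.
Qed.

Lemma log2_le (R : realType) (x y : R) : 0 < x -> x <= y -> log2 x <= log2 y.
Proof.
move=> x0 xy; rewrite /log2 ler_pM2r ?invr_gt0 ?ln_gt0 ?ltr1n //.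
by rewrite ler_ln ?posrE // (lt_le_trans x0).
Qed.

Lemma log2_pow2 (R : realType) (k : nat) : log2 (2 ^+ k : R) = k%:R.
Proof.
by rewrite /log2 lnXn // -[ln _ *+ k]mulr_natl mulfK // gt_eqF // ln_gt0 // ltr1n.
Qed.

(* Sum the tangent line inequality for [t ^ a] at [t = 1] over [t = c p], where
   [c] is the size of the support. *)
Lemma renyi_seq_le_log_supp (R : realType) (a : R) (s : seq R) (N : nat) :
  0 <= a -> (forall p : R, p \in s -> 0 <= p) -> \sum_(p <- s) p = 1 ->
  (count (fun p : R => p != 0%R) s <= N)%N -> renyi_seq a s <= log2 N%:R.
Proof.
move=> a0 s0 s1 cN; set c := count _ s in cN *.
have s1' : \sum_(p <- s | p != 0) p = 1.
  by rewrite -s1 big_mkcond /=; apply: eq_bigr => p _; case: eqP => //= ->.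
have c0 : 0 < c%:R :> R.
  rewrite ltr0n lt0n; apply: contra_eq_neq s1' => c0.
  rewrite big_hasC ?(eq_sym 0) ?oner_eq0 //.
  by rewrite has_count -/c c0.
suff : renyi_seq a s <= log2 c%:R.
  by move=> h; apply: le_trans h (log2_le _ _ _ c0 _); rewrite ler_nat.
have l2 : 0 < ln (2 : R) by rewrite ln_gt0 ?ltr1n.
have pP p : p \in s -> p != 0 -> 0 < p.
  by move=> ps pn; rewrite lt_neqAle eq_sym pn s0.
have sumc (x : R) : \sum_(p <- s | p != 0) x = c%:R * x.
  by rewrite big_const_seq iter_addr_0 mulr_natl.
rewrite /renyi_seq; case: ifP => [_|an0]; first exact: lexx.
case: ifP => [_|an1].
  have -> : log2 c%:R = \sum_(p <- s | p != 0) p * log2 (c%:R : R).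
    by rewrite -mulr_suml s1' mul1r.
  rewrite -sumrN -subr_le0 -sumrB.
  (* Shannon case: each term [p log2 (1 / (c p))] is at most [(1 / c - p) / ln 2], and these bounds
     sum to zero. *)
  have S0 : \sum_(p <- s | p != 0) (c%:R^-1 - p) / ln 2 = 0 :> R.
    by rewrite -mulr_suml sumrB sumc s1' divff ?gt_eqF // subrr mul0r.
  rewrite -[leRHS]S0 big_seq_cond [leRHS]big_seq_cond; apply: ler_sum => p /andP[ps pn].
  have p0 := pP _ ps pn.
  rewrite /log2 -mulNr !mulrA -mulrBl ler_pM2r ?invr_gt0 //.
  have h := ln_le_subr1 _ (c%:R * p)^-1; move: h.
  rewrite invr_gt0 mulr_gt0 // => /(_ isT).
  rewrite lnV ?posrE ?mulr_gt0 // lnM ?posrE // => h.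
  have : p * - (ln c%:R + ln p) <= p * ((c%:R * p)^-1 - 1) by rewrite ler_pM2l.
  rewrite invfM mulrBr mulrCA divff // mulr1. lra.
have E : \sum_(p <- s | p != 0) powR (c%:R * p) a
       = powR c%:R a * \sum_(p <- s | p != 0) powR p a.
  rewrite mulr_sumr big_seq_cond [RHS]big_seq_cond.
  by apply: eq_bigr => p /andP[ps pn]; rewrite powRM ?(ltW c0) ?s0.
(* The numbers [c p] have mean 1 over the support, so the linear terms of the tangents cancel. *)
have T : \sum_(p <- s | p != 0) (1 + a * (c%:R * p - 1)) = c%:R.
  rewrite big_split /= sumc -mulr_sumr sumrB sumc -mulr_sumr s1'; ring.
have ca : 0 < powR c%:R a by apply: powR_gt0.
have S0 : 0 < \sum_(p <- s | p != 0) powR p a.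
  have := s1'; case: (boolP (has (fun p => p != 0) s)); last first.
    by move=> hs; rewrite big_hasC // => /esym/eqP; rewrite oner_eq0.
  move=> /hasP[p ps pn] _.
  rewrite (big_rem p) //= pn; apply: ltr_pwDl; first by rewrite powR_gt0 ?pP.
  by apply: sumr_ge0 => q _; rewrite powR_ge0.
rewrite /log2 mulrA ler_pM2r ?invr_gt0 //.
have lnE : ln (powR c%:R a * \sum_(p <- s | p != 0) powR p a)
         = a * ln c%:R + ln (\sum_(p <- s | p != 0) powR p a).
  by rewrite lnM ?posrE // /powR gt_eqF // expRK.
(* Past [a = 1] both the tangent inequality and the sign of [1 - a] reverse, so the conclusion is
   the same. *)
case: (ltrP a 1) => a1.
  rewrite mulrC ler_pdivrMr ?subr_gt0 //.
  have : powR c%:R a * \sum_(p <- s | p != 0) powR p a <= c%:R.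
    rewrite -E -[leRHS]T big_seq_cond [leRHS]big_seq_cond.
    apply: ler_sum => p /andP[ps pn].
    by apply: powR_le_tangent; rewrite ?a0 ?(ltW a1) ?mulr_gt0 // pP.
  rewrite -ler_ln ?posrE ?mulr_gt0 // lnE; lra.
have {}a1 : 1 < a by rewrite lt_neqAle eq_sym an1.
rewrite -[1 - a]opprB invrN mulNr lerNl mulrC ler_pdivlMr ?subr_gt0 //.
have : c%:R <= powR c%:R a * \sum_(p <- s | p != 0) powR p a.
  rewrite -E -[leLHS]T big_seq_cond [leRHS]big_seq_cond.
  apply: ler_sum => p /andP[ps pn].
  by apply: powR_ge_tangent; rewrite ?a1 ?mulr_gt0 // pP.
rewrite -ler_ln ?posrE ?mulr_gt0 // lnE; lra.
Qed.

(* Each zero row of [M] contributes a factor ['X] to the characteristic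
   polynomial. *)
Lemma count_nonzero_roots_le (F : fieldType) (k : nat) (M : 'M[F]_k)
    (s : seq F) :
  char_poly M = \prod_(l <- s) ('X - l%:P) ->
  (count (fun l => l != 0%R) s <= #|[set i | row i M != 0%R]|)%N.
Proof.
move=> Es; set Z := [set i | _].
have szs : size s = k.
  by have := size_char_poly M; rewrite Es size_prod_XsubC => -[].
have [M' EM] : exists M' : 'M[{poly F}]_k,
    char_poly_mx M = diag_mx (\row_i (if i \in Z then 1 else 'X)) *m M'.
  exists (\matrix_(i, j) (if i \in Z then char_poly_mx M i j else (i == j)%:R)).
  apply/matrixP => i j; rewrite mul_diag_mx !mxE.
  case: ifPn => iZ; first by rewrite mul1r.
  have -> : M i j = 0.
    by move: iZ; rewrite inE negbK => /eqP/rowP/(_ j); rewrite !mxE.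
  by rewrite polyC0 subr0 mulr_natr.
have dvd : 'X^#|~: Z| %| \prod_(l <- s) ('X - l%:P).
  rewrite -Es /char_poly EM det_mulmx det_diag.
  rewrite (eq_bigr (fun i => if i \in ~: Z then 'X else 1)); last first.
    by move=> i _; rewrite mxE in_setC; case: (i \in Z).
  rewrite -big_mkcond /= prodr_const; exact: dvdp_mulIl.
have Ecount : \prod_(l <- s) ('X - l%:P) =
    'X^(count (fun l => l == 0) s) * \prod_(l <- s | l != 0) ('X - l%:P).
  rewrite (bigID (fun l => l == 0)) /=; congr (_ * _).
  rewrite (eq_bigr (fun=> 'X)); last by move=> l /eqP ->; rewrite subr0.
  by rewrite big_const_seq iter_mulr_1.
(* Otherwise, after cancelling the zero roots, ['X] would divide a product of factors with nonzero
   roots. *)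
have cZ : (#|~: Z| <= count (fun l => l == 0%R) s)%N.
  rewrite leqNgt; apply/negP => lt; move: dvd.
  rewrite Ecount -(subnKC (ltnW lt)) exprD dvdp_mul2l ?monic_neq0 ?monicXn //.
  move=> d; have : ('X - 0%:P) %| \prod_(l <- s | l != 0) ('X - l%:P).
    by apply: dvdp_trans d; rewrite subr0 -(@prednK (_ - _)) ?subn_gt0 // exprS dvdp_mulr.
  rewrite dvdp_XsubCl -big_filter root_prod_XsubC.
  by rewrite mem_filter eqxx.
have cs : (count (fun l => l == 0%R) s + count (fun l => l != 0%R) s = k)%N.
  by rewrite (count_predC (fun l => l == 0)) szs.
have cC : (#|Z| + #|~: Z| = k)%N by rewrite cardsC card_ord.
rewrite -(leq_add2l #|~: Z|) [X in (_ <= X)%N]addnC cC -[X in (_ <= X)%N]cs.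
by rewrite leq_add2r.
Qed.

(** Both sides are minus the coefficient of degree [k - 1] of the characteristic polynomial; [k = 0]
    is treated apart. *)
Lemma sum_roots_char_poly (F : fieldType) (k : nat) (M : 'M[F]_k) (s : seq F) :
  char_poly M = \prod_(l <- s) ('X - l%:P) -> \sum_(l <- s) l = \tr M.
Proof.
move=> Es.
have szs : size s = k.
  by have := size_char_poly M; rewrite Es size_prod_XsubC => -[].
case: k M Es szs => [|k] M Es szs.
  by move/size0nil: szs => ->; rewrite big_nil /mxtrace big_ord0.
have := @coefPn_prod_XsubC _ s; rewrite szs -Es => /(_ isT).
by rewrite char_poly_trace // => /oppr_inj.
Qed.

(** * Positivity and spectra of reduced states *)

Section Operators.
Context {R : realType}.
Local Notation C := (R[i]).

Lemma ReD (x y : C) : complex.Re (x + y) = complex.Re x + complex.Re y.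
Proof. by case: x; case: y. Qed.

Lemma Re_sum (I : Type) (r : seq I) (P : pred I) (F : I -> C) :
  complex.Re (\sum_(i <- r | P i) F i) = \sum_(i <- r | P i) complex.Re (F i).
Proof. exact: (big_morph _ ReD). Qed.

Lemma ReZ (x : R) (y : C) : complex.Re (x%:C%C * y) = x * complex.Re y.
Proof. by case: y => a b /=; rewrite mul0r subr0. Qed.

Lemma Re_ge0 (x : C) : 0 <= x -> 0 <= complex.Re x.
Proof. by rewrite lecE => /andP[]. Qed.

Lemma psd_root_ge0 (T : finType) (A : op R T) (l : C) :
  psd A -> root (char_poly (mx_of A)) l -> 0 <= l.
Proof.
move=> psdA; rewrite -eigenvalue_root_char => /eigenvalueP[v vA v0].
(* The eigenvector [v] is a row acting from the left, so the quadratic form is evaluated at its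
   conjugate. *)
pose u (a : T) := (v 0 (enum_rank a))^*%C.
have := psdA u.
have -> : \sum_a \sum_b conjc (u a) * A a b * u b
        = l * \sum_b v 0 (enum_rank b) * (v 0 (enum_rank b))^*%C.
  rewrite exchange_big mulr_sumr; apply: eq_bigr => b _.
  rewrite -mulr_suml mulrA; congr (_ * _).
  have := congr1 (fun w : 'rV_ _ => w 0 (enum_rank b)) vA.
  rewrite !mxE => <-; rewrite (reindex (fun i : 'I_#|T| => enum_val i)) /=; last first.
    by exists enum_rank => x _; rewrite ?enum_valK ?enum_rankK.
  by apply: eq_bigr => i _; rewrite /u conjcK enum_valK !mxE enum_rankK.
have [j vj] : exists j, v 0 j != 0.
  by apply/existsP; apply: contraNT v0; rewrite negb_exists => /forallP h;
     apply/eqP/rowP => j; rewrite mxE; have := h j; rewrite negbK => /eqP.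
rewrite pmulr_lge0 // (bigD1 (enum_val j)) //= enum_valK ltr_pwDl //.
  by rewrite lt_neqAle mulcJ_ge0 andbT eq_sym mulf_neq0 // conjc_eq0.
by apply: sumr_ge0 => i _; apply: mulcJ_ge0.
Qed.

Lemma mxtrace_mx_of (T : finType) (A : op R T) : \tr (mx_of A) = op_tr A.
Proof.
rewrite /mxtrace /op_tr (reindex (fun i : 'I_#|T| => enum_val i)) /=.
  by apply: eq_bigr => i _; rewrite mxE.
by exists enum_rank => x _; rewrite ?enum_valK ?enum_rankK.
Qed.

Definition proj_in (n : nat) (A : {set 'I_n}) (a : qbasis n) : subbasis A :=
  [ffun i => a (val i)].
Definition proj_out (n : nat) (A : {set 'I_n}) (a : qbasis n) : csubbasis A :=
  [ffun i => a (val i)].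

(** Eliminator for the dependent match inside [join]: the return clause is written once here, and
    the membership proofs in the branches become arbitrary. *)
Lemma join_ind (n : nat) (A : {set 'I_n}) (a : subbasis A) (b : csubbasis A)
    (i : 'I_n) (P : bool -> Prop) :
  (forall h : i \in A, P (a (exist _ i h))) ->
  (forall h : i \notin A, P (b (exist _ i h))) -> P (join a b i).
Proof.
move=> h1 h2; rewrite ffunE.
exact: (match boolP (i \in A) as s in alt_spec _ _ b' return
          P (match s with
             | AltTrue h => a (exist _ i h)
             | AltFalse h => b (exist _ i h)
             end)
        with AltTrue h => h1 h | AltFalse h => h2 h end).
Qed.

Lemma join_proj (n : nat) (A : {set 'I_n}) (a : qbasis n) :
  join (proj_in n A a) (proj_out n A a) = a.
Proof. by apply/ffunP => i; elim/join_ind: _ => h; rewrite ffunE. Qed.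

Lemma proj_in_join (n : nat) (A : {set 'I_n}) (a : subbasis A) (b : csubbasis A) :
  proj_in n A (join a b) = a.
Proof.
apply/ffunP => -[i hi]; rewrite ffunE /=; elim/join_ind: _ => h.
  by congr (a _); apply: val_inj.
by case/negP: (h).
Qed.

Lemma proj_out_join (n : nat) (A : {set 'I_n}) (a : subbasis A) (b : csubbasis A) :
  proj_out n A (join a b) = b.
Proof.
apply/ffunP => -[i hi]; rewrite ffunE /=; elim/join_ind: _ => h.
  by case/negP: (hi).
by congr (b _); apply: val_inj.
Qed.

Lemma sum_join (n : nat) (A : {set 'I_n}) (F : qbasis n -> C) :
  \sum_a F a = \sum_(a : subbasis A) \sum_(b : csubbasis A) F (join a b).
Proof.
rewrite pair_big /= (reindex (fun p : subbasis A * csubbasis A => join p.1 p.2)) //=.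
exists (fun a => (proj_in n A a, proj_out n A a)) => [[a b]|a] _ /=.
  by rewrite proj_in_join proj_out_join.
by rewrite join_proj.
Qed.

(** The quadratic form is a sum of squared moduli over the basis states [b] of the complement: [z b]
    is the overlap of [v] with the slice of [psi] at [b]. *)
Lemma psd_ptrace (n : nat) (A : {set 'I_n}) (psi : qbasis n -> C) :
  psd (ptrace A (density psi)).
Proof.
move=> v; pose z b := \sum_a conjc (v a) * psi (join a b).
suff -> : \sum_a \sum_a' conjc (v a) * ptrace A (density psi) a a' * v a'
        = \sum_b z b * conjc (z b).
  by apply: sumr_ge0 => b _; apply: mulcJ_ge0.
rewrite /z; under [RHS]eq_bigr => b _.
  rewrite rmorph_sum mulr_suml /=; under eq_bigr do rewrite mulr_sumr.
  over.
rewrite [RHS]exchange_big; apply: eq_bigr => a _ /=.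
rewrite [RHS]exchange_big; apply: eq_bigr => a' _ /=.
rewrite /ptrace mulr_sumr mulr_suml; apply: eq_bigr => b _.
by rewrite rmorphM /= conjcK /density; ring.
Qed.

(** The eigenvalues of the reduced state form a probability vector. A row of that state vanishes
    unless its index is the restriction to [A] of an element of [T], which bounds the number of
    nonzero eigenvalues by the size of [T]. *)
Lemma ent_entropy_lt_supp (n : nat) (alpha bound : R) (psi : qbasis n -> C)
    (T : {set qbasis n}) (A : {set 'I_n}) :
  0 <= alpha -> is_pure_state psi -> (forall a, a \notin T -> psi a = 0) ->
  log2 #|T|%:R < bound -> ent_entropy_lt alpha psi A bound.
Proof.
move=> alpha0 pure supp lt s sp; apply: le_lt_trans lt.
apply: renyi_seq_le_log_supp => //.
- move=> p /mapP[l ls ->]; apply: Re_ge0; apply: psd_root_ge0 (psd_ptrace _ A psi) _.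
  by rewrite sp root_prod_XsubC.
- rewrite big_map -Re_sum (sum_roots_char_poly _ _ _ _ sp) mxtrace_mx_of.
  suff -> : op_tr (ptrace A (density psi)) = 1 by [].
  by rewrite -pure (sum_join n A (fun a => psi a * conjc (psi a))).
rewrite count_map; apply: leq_trans (_ : (count (fun l => l != 0%R) s <= _)%N).
  by apply: sub_count => l /=; apply: contra_neq => ->.
apply: leq_trans (count_nonzero_roots_le _ _ _ _ sp) _.
apply: leq_trans (leq_imset_card (fun a => enum_rank (proj_in n A a)) (mem T)).
apply/subset_leq_card/subsetP => i; rewrite inE => ri.
suff [b bT] : exists b, join (enum_val i) b \in T.
  by apply/imsetP; exists (join (enum_val i) b); rewrite ?proj_in_join ?enum_valK.
apply/existsP; apply: contraNT ri; rewrite negb_exists => /forallP h.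
apply/eqP/rowP => j; rewrite !mxE /ptrace big1 // => b _.
by rewrite /density supp ?mul0r.
Qed.

End Operators.

(** * Pauli distributions *)

Definition shift (n : nat) (a v : qbasis n) : qbasis n := [ffun j => a j (+) v j].
Definition dotb (n : nat) (v w : qbasis n) : nat := (\sum_j (v j && w j))%N.
Definition mk_label (n : nat) (v w : qbasis n) : plabel n := [ffun j => (v j, w j)].
Definition xpart (n : nat) (x : plabel n) : qbasis n := [ffun j => (x j).1].
Definition zpart (n : nat) (x : plabel n) : qbasis n := [ffun j => (x j).2].
Definition zerob (n : nat) : qbasis n := [ffun=> false].

Lemma card_qbasis (n : nat) : #|{: qbasis n}| = (2 ^ n)%N.
Proof. by rewrite card_ffun card_bool card_ord. Qed.

Lemma shiftK (n : nat) (v : qbasis n) : involutive (fun a => shift n a v).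
Proof. by move=> a; apply/ffunP => j; rewrite !ffunE addbK. Qed.

Lemma shiftC (n : nat) (a v : qbasis n) : shift n a v = shift n v a.
Proof. by apply/ffunP => j; rewrite !ffunE addbC. Qed.

Lemma shift0 (n : nat) (a : qbasis n) : shift n a (zerob n) = a.
Proof. by apply/ffunP => j; rewrite !ffunE addbF. Qed.

Lemma shift_eq0 (n : nat) (a b : qbasis n) : (shift n a b == zerob n) = (a == b).
Proof.
apply/eqP/eqP => [/ffunP h|->]; apply/ffunP => j; last by rewrite !ffunE addbb.
by have := h j; rewrite !ffunE; case: (a j); case: (b j).
Qed.

Lemma dotbC (n : nat) (v w : qbasis n) : dotb n v w = dotb n w v.
Proof. by apply: eq_bigr => j _; rewrite andbC. Qed.

Lemma mk_label_parts (n : nat) (x : plabel n) : mk_label n (xpart n x) (zpart n x) = x.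
Proof. by apply/ffunP => j; rewrite !ffunE; case: (x j). Qed.

Lemma xpart_mk (n : nat) (v w : qbasis n) : xpart n (mk_label n v w) = v.
Proof. by apply/ffunP => j; rewrite !ffunE. Qed.

Lemma zpart_mk (n : nat) (v w : qbasis n) : zpart n (mk_label n v w) = w.
Proof. by apply/ffunP => j; rewrite !ffunE. Qed.

Lemma sum_label (V : nmodType) (n : nat) (F : plabel n -> V) :
  \sum_x F x = \sum_v \sum_w F (mk_label n v w).
Proof.
rewrite pair_big /= (reindex (fun p : qbasis n * qbasis n => mk_label n p.1 p.2)) //=.
exists (fun x => (xpart n x, zpart n x)) => [[v w]|x] _ /=.
  by rewrite xpart_mk zpart_mk.
exact: mk_label_parts.
Qed.

Lemma sign_dotb (K : comNzRingType) (n : nat) (v w : qbasis n) :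
  (-1) ^+ dotb n v w = \prod_j (-1) ^+ (v j && w j) :> K.
Proof. by rewrite -prodrXr. Qed.

Lemma sign_dotb_shift (K : comNzRingType) (n : nat) (v a b : qbasis n) :
  (-1) ^+ dotb n v (shift n a b) = (-1) ^+ dotb n v a * (-1) ^+ dotb n v b :> K.
Proof.
rewrite !sign_dotb -big_split; apply: eq_bigr => j _; rewrite ffunE /=.
by case: (v j); case: (a j); case: (b j) => /=;
   rewrite ?expr0 ?expr1 ?mulr1 ?mul1r ?mulrN1 ?opprK.
Qed.

(** Orthogonality of the characters of the group of bit strings: the sum factors over the qubits,
    and a qubit with [u j] true contributes [1 - 1]. *)
Lemma sum_sign_dotb (K : comNzRingType) (n : nat) (u : qbasis n) :
  \sum_w (-1) ^+ dotb n u w = (u == zerob n)%:R * 2 ^+ n :> K.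
Proof.
under eq_bigr do rewrite sign_dotb.
rewrite -(bigA_distr_bigA (fun j e => (-1) ^+ (u j && e))) /=.
case: eqP => [->|/eqP u0].
  rewrite mul1r (eq_bigr (fun=> 2)); first by rewrite prodr_const card_ord.
  by move=> j _; rewrite big_bool ffunE /= !expr0.
have [j uj] : exists j, u j.
  apply/existsP; apply: contraNT u0; rewrite negb_exists => /forallP h.
  by apply/eqP/ffunP => j; rewrite ffunE; apply/negbTE/h.
by rewrite (bigD1 j) //= big_bool uj /= expr1 expr0 addNr !mul0r.
Qed.

Lemma pauli1E (R : realType) (vw : bool * bool) (a b : bool) :
  pauli1 R vw a b = (a == b (+) vw.1)%:R * (-1) ^+ (vw.2 && b).
Proof.
case: vw => v w; rewrite /pauli1 /op_mul big_bool /= /pX /pZ /op_id.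
by case: v; case: w; case: a; case: b;
   rewrite /= ?expr0 ?expr1 ?mul1r ?mul0r ?mulr0 ?mulr1 ?addr0 ?add0r.
Qed.

Section Pauli.
Context {R : realType}.
Local Notation C := (R[i]).

Lemma pauliE (n : nat) (v w : qbasis n) (a b : qbasis n) :
  pauli R (mk_label n v w) a b
  = 'i%C ^+ dotb n v w * ((a == shift n b v)%:R * (-1) ^+ dotb n w b).
Proof.
rewrite /pauli; congr (_ ^+ _ * _).
  by apply: eq_bigr => j _; rewrite ffunE.
rewrite sign_dotb; under [LHS]eq_bigr do rewrite pauli1E ffunE.
rewrite big_split /=; congr (_ * _).
case: eqP => [->|/eqP ab]; first by rewrite big1 // => j _; rewrite ffunE eqxx.
have [j nj] : exists j, a j != shift n b v j.
  apply/existsP; apply: contraNT ab; rewrite negb_exists => /forallP h.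
  by apply/eqP/ffunP => j; apply/eqP; have := h j; rewrite negbK.
by rewrite (bigD1 j) //=; move: nj; rewrite ffunE => /negbTE ->; rewrite mul0r.
Qed.

(* The expectation of [X^v Z^w], i.e. of a Pauli string without its phase. *)
Definition corr (n : nat) (psi : qbasis n -> C) (v w : qbasis n) : C :=
  \sum_a psi a * conjc (psi (shift n a v)) * (-1) ^+ dotb n w a.

Lemma tr_density_pauli (n : nat) (psi : qbasis n -> C) (v w : qbasis n) :
  op_tr (op_mul (density psi) (pauli R (mk_label n v w)))
  = 'i%C ^+ dotb n v w * corr n psi v w.
Proof.
rewrite /op_tr /op_mul /corr mulr_sumr; apply: eq_bigr => a _.
rewrite (bigD1 (shift n a v)) //= big1 ?addr0.
  by rewrite pauliE eqxx /density mul1r mulrCA.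
by move=> c /negbTE ca; rewrite pauliE ca mul0r !mulr0.
Qed.

Lemma conj_sign (k : nat) : conjc ((-1) ^+ k : C) = (-1) ^+ k.
Proof. by rewrite rmorphXn rmorphN rmorph1. Qed.

(** Shifting the summation variable by [v] exchanges the two factors of [psi]. Equivalently, the
    expectation [i^(v.w) corr] of a Pauli string is real. *)
Lemma conj_corr (n : nat) (psi : qbasis n -> C) (v w : qbasis n) :
  conjc (corr n psi v w) = (-1) ^+ dotb n v w * corr n psi v w.
Proof.
rewrite /corr rmorph_sum mulr_sumr (reindex_inj (inv_inj (shiftK n v))) /=.
apply: eq_bigr => a _; rewrite !rmorphM /= conjcK shiftK conj_sign.
by rewrite sign_dotb_shift (dotbC n v w); ring.
Qed.

(** The squared phase is the sign of [conj_corr], so the squared expectation is a squared modulus;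
    purity gives the denominator. *)
Lemma pauli_distE (n : nat) (psi : qbasis n -> C) (v w : qbasis n) :
  is_pure_state psi ->
  pauli_dist (density psi) (mk_label n v w)
  = (2 ^+ n)^-1 * complex.Re (corr n psi v w * conjc (corr n psi v w)).
Proof.
move=> pure; rewrite /pauli_dist tr_density_pauli.
have -> : op_tr (op_mul (density psi) (density psi)) = 1.
  rewrite /op_tr /op_mul /density.
  rewrite -[RHS](mulr1 1) -{1}pure -pure mulr_suml; apply: eq_bigr => a _.
  by rewrite mulr_sumr; apply: eq_bigr => b _; ring.
rewrite mulr1 exprMn -exprM mulnC exprM sqr_i.
have -> : corr n psi v w * conjc (corr n psi v w)
        = (-1) ^+ dotb n v w * corr n psi v w ^+ 2 by rewrite conj_corr; ring.
rewrite mulrC -ReZ; congr (complex.Re (_ * _)).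
by rewrite fmorphV.
Qed.

(** Expand the square and sum over [w] first: by character orthogonality only the diagonal
    survives. *)
Lemma parseval (n : nat) (F : qbasis n -> C) :
  \sum_w (\sum_a F a * (-1) ^+ dotb n w a) * conjc (\sum_a F a * (-1) ^+ dotb n w a)
  = 2 ^+ n * \sum_a F a * conjc (F a).
Proof.
transitivity (\sum_a \sum_b F a * conjc (F b) * \sum_w (-1) ^+ dotb n (shift n a b) w).
  under eq_bigr => w _.
    rewrite rmorph_sum mulr_suml; under eq_bigr do rewrite mulr_sumr.
    over.
  rewrite exchange_big; apply: eq_bigr => a _ /=.
  rewrite exchange_big; apply: eq_bigr => b _ /=.
  rewrite mulr_sumr; apply: eq_bigr => w _.
  by rewrite rmorphM /= conj_sign (dotbC n _ w) sign_dotb_shift; ring.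
rewrite mulr_sumr; apply: eq_bigr => a _.
rewrite (bigD1 a) //= [X in _ + X]big1 => [|b ba].
  by rewrite sum_sign_dotb shift_eq0 eqxx mul1r addr0 mulrC.
by rewrite sum_sign_dotb shift_eq0 eq_sym (negbTE ba) mul0r mulr0.
Qed.

(** For fixed [v], [corr] is the Walsh-Hadamard transform in [w] of
    [psi a * conjc (psi (shift n a v))], so [parseval] applies. *)
Lemma sum_pauli_dist_z (n : nat) (psi : qbasis n -> C) (v : qbasis n) :
  is_pure_state psi ->
  \sum_w pauli_dist (density psi) (mk_label n v w)
  = complex.Re (\sum_a (psi a * conjc (psi a))
                  * (psi (shift n a v) * conjc (psi (shift n a v)))).
Proof.
move=> pure; under eq_bigr do rewrite pauli_distE //.
rewrite -mulr_sumr -Re_sum parseval.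
have -> : (2 : C) ^+ n = (2 ^+ n : R)%:C%C by rewrite rmorphXn /= rmorph_nat.
rewrite ReZ mulrA mulVf ?mul1r ?expf_neq0 ?pnatr_eq0 //; congr complex.Re.
by apply: eq_bigr => a _; rewrite rmorphM /= conjcK; ring.
Qed.

Lemma sum_pauli_dist (n : nat) (psi : qbasis n -> C) :
  is_pure_state psi -> \sum_x pauli_dist (density psi) x = 1.
Proof.
move=> pure; rewrite sum_label; under eq_bigr do rewrite sum_pauli_dist_z //.
rewrite -Re_sum exchange_big /=.
rewrite (eq_bigr (fun a => psi a * conjc (psi a))) => [|a _]; first by rewrite pure.
rewrite -mulr_sumr -[RHS]mulr1; congr (_ * _).
rewrite (reindex_inj (inv_inj (shiftK n a))) /= -[RHS]pure.
by apply: eq_bigr => v _; rewrite (shiftC n a) shiftK.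
Qed.

Lemma pauli_dist_ge0 (n : nat) (psi : qbasis n -> C) (x : plabel n) :
  is_pure_state psi -> 0 <= pauli_dist (density psi) x.
Proof.
move=> pure; rewrite -(mk_label_parts n x) pauli_distE // mulr_ge0 ?invr_ge0 ?exprn_ge0 //.
by apply: Re_ge0; apply: mulcJ_ge0.
Qed.

(* [psi] is fixed by the antiunitary [Z^b K], with [K] complex conjugation, so
   the Pauli strings anticommuting with it have zero expectation. *)
Lemma corr_eq0 (n : nat) (psi : qbasis n -> C) (b v w : qbasis n) :
  (forall a, conjc (psi a) = (-1) ^+ dotb n b a * psi a) ->
  odd (dotb n v w + dotb n v b) -> corr n psi v w = 0.
Proof.
move=> psib ovw; apply/eqP.
have E : corr n psi v w = (-1) ^+ dotb n v b * conjc (corr n psi v w).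
  rewrite /corr rmorph_sum mulr_sumr; apply: eq_bigr => a _.
  rewrite !rmorphM /= conjcK conj_sign !psib sign_dotb_shift (dotbC n v b).
  by ring.
move: E; rewrite conj_corr mulrA -exprD addnC -signr_odd ovw expr1 mulN1r.
by move/eqP; rewrite eq_sym eqNr.
Qed.

End Pauli.

(** * Measurements on copies of phase states *)

(** The birthday bound with denominators cleared: [m] uniform draws from [d] values collide with
    probability at most [m^2 / d]. *)
Lemma expn_le_ffact (d m : nat) : (d ^ m * d <= d ^_ m * d + m ^ 2 * d ^ m)%N.
Proof.
have le k : (d ^_ k <= d ^ k)%N.
  by elim: k => // k IH; rewrite ffactnSr expnSr leq_mul // leq_subr.
elim: m => [|m IH]; first by rewrite ffactn0 expn0 muln1 leq_addr.
(* Subtraction is truncated; this inequality holds for [m > d] as well. *)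
rewrite ffactnSr expnSr; have := le m; have : (d <= (d - m) + m)%N by lia.
move: (d - m)%N (d ^_ m) (d ^ m)%N IH => r F D IH rd FD.
have h1 : (F * d * d <= F * (r + m) * d)%N by rewrite leq_mul2r leq_mul2l rd !orbT.
have h2 : (F * m * d <= D * m * d)%N by rewrite !leq_mul2r FD !orbT.
have h3 : (D * d * d <= (F * d + m ^ 2 * D) * d)%N by rewrite leq_mul2r IH orbT.
nia.
Qed.

(** As the totals agree, [S] and its complement contribute the same difference, which absorbs the
    factor 1/2. *)
Lemma tv_dist_event (R : realType) (T : finType) (p q : T -> R) (S : pred T) :
  \sum_x p x = 1 -> \sum_x q x = 1 ->
  \sum_(x | S x) p x - \sum_(x | S x) q x <= tv_dist p q.
Proof.
move=> p1 q1; rewrite /tv_dist [X in _ * X](bigID S) /=.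
have hS : \sum_(x | S x) p x - \sum_(x | S x) q x <= \sum_(x | S x) `|p x - q x|.
  by rewrite -sumrB; apply: ler_sum => x _; apply: ler_norm.
have hN : \sum_(x | ~~ S x) q x - \sum_(x | ~~ S x) p x
          <= \sum_(x | ~~ S x) `|p x - q x|.
  by rewrite -sumrB; apply: ler_sum => x _; rewrite distrC ler_norm.
move: p1 q1; rewrite (bigID S) /= => p1; rewrite (bigID S) /= => q1; lra.
Qed.

Section Measurement.
Context {R : realType}.
Local Notation C := (R[i]).
Variables (T O : finType).

(** Positivity at [u / 2 - 2 v] bounds the cross terms. The uneven weights matter: later the [u]
    part is multiplied by 1/2, and 5/4 keeps it at 5/8, below 2/3, whereas the symmetric weight 2
    would give 1. *)
Lemma psd_qform_add (A : op R T) (u v : T -> C) : psd A ->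
  complex.Re (\sum_a \sum_b conjc (u a + v a) * A a b * (u b + v b))
  <= 5 / 4 * complex.Re (\sum_a \sum_b conjc (u a) * A a b * u b)
     + 5 * complex.Re (\sum_a \sum_b conjc (v a) * A a b * v b).
Proof.
move=> psdA; have := Re_ge0 _ (psdA (fun a => (2^-1)%:C%C * u a - 2%:C%C * v a)).
have -> : \sum_a \sum_b conjc ((2^-1)%:C%C * u a - 2%:C%C * v a) * A a b
                     * ((2^-1)%:C%C * u b - 2%:C%C * v b)
   = (5 / 4 : R)%:C%C * (\sum_a \sum_b conjc (u a) * A a b * u b)
     + (5 : R)%:C%C * (\sum_a \sum_b conjc (v a) * A a b * v b)
     - (1 : R)%:C%C * \sum_a \sum_b conjc (u a + v a) * A a b * (u b + v b).
  rewrite !mulr_sumr -big_split -sumrB; apply: eq_bigr => a _ /=.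
  rewrite !mulr_sumr -big_split -sumrB; apply: eq_bigr => b _ /=.
  have e2 : (2^-1 : R)%:C%C = 2^-1 by rewrite fmorphV rmorph_nat.
  have e54 : (5 / 4 : R)%:C%C = 5 / 4 by rewrite fmorph_div !rmorph_nat.
  have cZ (x : R) (y : C) : conjc (x%:C%C * y) = x%:C%C * conjc y.
    by rewrite rmorphM; congr (_ * _); apply: conjc_real.
  have cB (x y : C) : conjc (x - y) = conjc x - conjc y by rewrite rmorphB.
  have cD (x y : C) : conjc (x + y) = conjc x + conjc y by rewrite rmorphD.
  rewrite cB !cZ cD e2 e54 rmorph1 !rmorph_nat.
  by field.
have ReN (x : C) : complex.Re (- x) = - complex.Re x by case: x.
rewrite !(ReD, ReN, ReZ); lra.
Qed.

(** Stated without normalisation, so that it applies to the collision-free and colliding parts of a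
    state. *)
Lemma sum_outcome_dist (E : O -> op R T) (u : T -> C) : is_povm E ->
  \sum_o outcome_dist E u o = complex.Re (\sum_a u a * conjc (u a)).
Proof.
case=> _ E1; rewrite /outcome_dist -Re_sum exchange_big; congr complex.Re.
apply: eq_bigr => a _ /=; rewrite exchange_big (bigD1 a) //= [X in _ + X]big1 => [|b ba].
  by rewrite -mulr_suml -mulr_sumr E1 /op_id eqxx mulr1 addr0 mulrC.
by rewrite -mulr_suml -mulr_sumr E1 /op_id eq_sym (negbTE ba) mulr0 mul0r.
Qed.

Lemma outcome_dist_ge0 (E : O -> op R T) (u : T -> C) (o : O) :
  is_povm E -> 0 <= outcome_dist E u o.
Proof. by case=> psdE _; apply: Re_ge0; apply: psdE. Qed.

End Measurement.

(** * Phase states, their copies and the collision weight *)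

Section PhaseStates.
Context {R : realType}.
Local Notation C := (R[i]).
Variables (n m : nat) (T : {set qbasis n}).
Hypothesis T_gt0 : (0 < #|T|)%N.
Local Notation d := (#|T|%:R : R).
Implicit Types (b : qbasis n) (s : {ffun qbasis n -> bool}).

(* [b] twists the random real phases [s] by the Clifford phase gates
   [S^b_1 (x) ... (x) S^b_n]. *)
Definition phase_state b s (a : qbasis n) : C :=
  (a \in T)%:R * ((Num.sqrt d)^-1)%:C%C * 'i%C ^+ dotb n b a * (-1) ^+ s a.

(** Conjugation sends [i] to [-i]. The exponent [dotb n b a] is an integer count, of which the sign
    keeps the parity. *)
Lemma conj_phase_state b s a :
  conjc (phase_state b s a) = (-1) ^+ dotb n b a * phase_state b s a.
Proof.
rewrite /phase_state; have := conjc_real (Num.sqrt d)^-1; set x := (_%:C)%C => cx.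
have ci : conjc 'i%C = - 'i%C :> C by apply/eqP; rewrite eq_complex /= oppr0 !eqxx.
move: x cx ('i%C) ci => x cx y ci.
rewrite !rmorphM /= cx conjc_nat conj_sign rmorphXn /= ci.
rewrite [(- y) ^+ _]exprNn.
move: ((a \in T)%:R : C) ((-1) ^+ dotb n b a : C) (y ^+ _) ((-1) ^+ s a : C).
by move=> r g h e; ring.
Qed.

Lemma phase_state_sqr b s a :
  phase_state b s a * conjc (phase_state b s a) = ((a \in T)%:R / d)%:C%C.
Proof.
rewrite conj_phase_state.
have iS : (-1) ^+ dotb n b a * ('i%C ^+ dotb n b a) ^+ 2 = 1 :> C.
  by rewrite -exprM mulnC exprM sqr_i -exprMn mulrNN mulr1 expr1n.
have sS : ((-1) ^+ s a) ^+ 2 = 1 :> C by rewrite sqrr_sign.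
have -> : ((a \in T)%:R / d)%:C%C = (a \in T)%:R ^+ 2 * ((Num.sqrt d)^-1)%:C%C ^+ 2 :> C.
  have <- : (Num.sqrt d)^-1 ^+ 2 = d^-1 by rewrite exprVn sqr_sqrtr ?ler0n.
  rewrite rmorphM rmorphXn rmorph_nat.
  by case: (a \in T); rewrite ?expr1n ?expr0n.
rewrite /phase_state; move: iS sS.
move: ((a \in T)%:R : C) ((-1) ^+ dotb n b a : C) ('i%C ^+ _) ((-1) ^+ s a : C).
move: (_%:C%C : C) => x r g h e gh e1.
transitivity (r ^+ 2 * x ^+ 2 * (g * h ^+ 2) * e ^+ 2); first by ring.
by rewrite gh e1 !mulr1.
Qed.

Lemma sum_support : \sum_a ((a \in T)%:R / d) = 1.
Proof.
by rewrite -mulr_suml -natr_sum -big_mkcond sum1_card divff // pnatr_eq0 -lt0n.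
Qed.

Lemma phase_state_pure b s : is_pure_state (phase_state b s).
Proof.
rewrite /is_pure_state; under eq_bigr do rewrite phase_state_sqr.
by rewrite -rmorph_sum /= sum_support.
Qed.

Lemma tensor_phase_sqr b s (c : copies_basis m n) :
  tensor_power m (phase_state b s) c * conjc (tensor_power m (phase_state b s) c)
  = (\prod_k ((c k \in T)%:R / d))%:C%C.
Proof.
rewrite /tensor_power rmorph_prod -big_split rmorph_prod; apply: eq_bigr => k _.
exact: phase_state_sqr.
Qed.

Lemma sum_tensor_weight :
  \sum_(c : copies_basis m n) \prod_k ((c k \in T)%:R / d) = 1.
Proof.
rewrite -(bigA_distr_bigA (fun=> fun a => (a \in T)%:R / d)) /=.
by rewrite big1 // => k _; apply: sum_support.
Qed.

Lemma tensor_phase_pure b s : is_pure_state (tensor_power m (phase_state b s)).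
Proof.
rewrite /is_pure_state; under eq_bigr do rewrite tensor_phase_sqr.
by rewrite -rmorph_sum /= sum_tensor_weight.
Qed.

(** The weights are the uniform distribution on [m]-tuples from [T], so this is the birthday bound
    [expn_le_ffact]. *)
Lemma collision_weight :
  \sum_(c : copies_basis m n | ~~ injectiveb c) \prod_k ((c k \in T)%:R / d)
  <= m%:R ^+ 2 / d.
Proof.
have d0 : 0 < d by rewrite ltr0n.
have E : \sum_(c : copies_basis m n | injectiveb c) \prod_k ((c k \in T)%:R / d)
       = (#|T| ^_ m)%:R / d ^+ m.
  under eq_bigr => c _.
    rewrite big_split /= prodr_const card_ord exprVn.
    have -> : \prod_k (c k \in T)%:R = (c \in ffun_on (mem T))%:R :> R.
      case: (boolP (c \in _)) => [/ffun_onP h|].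
        by rewrite big1 // => k _; rewrite h.
      move=> h; have [k hk] : exists k, c k \notin T.
        apply/existsP; apply: contraNT h; rewrite negb_exists => /forallP h.
        by apply/ffun_onP => k; have := h k; rewrite negbK.
      by rewrite (bigD1 k) //= (negbTE hk) mul0r.
    over.
  rewrite -mulr_suml -natr_sum; congr (_%:R / _).
  have := card_inj_ffuns_on 'I_m (mem T); rewrite [#|'I_m|]card_ord => <-.
  rewrite -sum1_card big_mkcond [RHS]big_mkcond /=; apply: eq_bigr => c _.
  by rewrite !inE; case: (injectiveb c); rewrite ?andbT ?andbF //; case: (c \in _).
have := sum_tensor_weight; rewrite (bigID (fun c : copies_basis m n => injectiveb c)) /= E.
have : d ^+ m * d <= (#|T| ^_ m)%:R * d + m%:R ^+ 2 * d ^+ m.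
  by rewrite -!natrX -!natrM -natrD ler_nat expn_le_ffact.
have D0 : 0 < d ^+ m by rewrite exprn_gt0.
move=> h1 h2; have {h2} -> : \sum_(c : copies_basis m n | ~~ injectiveb c)
   \prod_k ((c k \in T)%:R / d) = 1 - (#|T| ^_ m)%:R / d ^+ m by lra.
rewrite ler_pdivlMr // -(ler_pM2r D0) mulrAC mulrBl divfK ?gt_eqF //.
rewrite mulrBl mul1r; lra.
Qed.

(** * The collision-free part averaged over the signs *)

Definition inj_part (u : copies_basis m n -> C) (c : copies_basis m n) : C :=
  (injectiveb c)%:R * u c.
Definition coll_part (u : copies_basis m n -> C) (c : copies_basis m n) : C :=
  (~~ injectiveb c)%:R * u c.

Definition flip (z : qbasis n) s : {ffun qbasis n -> bool} :=
  [ffun a => s a (+) (a == z)].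

Lemma flipK z : involutive (flip z).
Proof. by move=> s; apply/ffunP => a; rewrite !ffunE addbK. Qed.

(** By injectivity [z] occurs at most once in [c], so its sign enters the product at most once. *)
Lemma tensor_phase_flip b z s (c : copies_basis m n) : injective c ->
  tensor_power m (phase_state b (flip z s)) c
  = (-1) ^+ (z \in codom c) * tensor_power m (phase_state b s) c.
Proof.
move=> injc.
have -> : (-1) ^+ (z \in codom c) = \prod_k (-1) ^+ (c k == z) :> C.
  case: (boolP (z \in codom c)) => [/codomP[k ->]|zc].
    rewrite (bigD1 k) //= eqxx big1 ?mulr1 // => j jk.
    by rewrite (inj_eq injc) (negbTE jk).
  rewrite big1 // => k _; case: eqP => // ck.
  by case/negP: zc; rewrite -ck codom_f.
rewrite /tensor_power -big_split; apply: eq_bigr => k _.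
rewrite /phase_state ffunE signr_addb /=.
move: ((-1) ^+ (c k == z) : C) ((-1) ^+ s (c k) : C) (_ * 'i%C ^+ _) => g h e.
by rewrite mulrA mulrC.
Qed.

(** Up to the number of sign functions, an entry of the averaged density operator of the [m]
    copies. *)
Definition avg_inj_moment (c c' : copies_basis m n) b : C :=
  \sum_s conjc (tensor_power m (phase_state b s) c) * tensor_power m (phase_state b s) c'.

Lemma avg_inj_moment_indep (c c' : copies_basis m n) b :
  injective c -> injective c' ->
  avg_inj_moment c c' b = avg_inj_moment c c' (zerob n).
Proof.
move=> injc injc'; rewrite /avg_inj_moment.
case: (boolP [forall z, (z \in codom c) == (z \in codom c')]) => [/forallP eqc|].
  have perm b1 s : tensor_power m (phase_state b1 s) c'
                   = tensor_power m (phase_state b1 s) c.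
    have im (e : copies_basis m n) : injective e -> tensor_power m (phase_state b1 s) e
        = \prod_(a | a \in codom e) phase_state b1 s a.
      move=> inje; rewrite /tensor_power -(big_map e xpredT (phase_state b1 s)) /=.
      rewrite -[RHS]big_filter; apply: perm_big; apply: uniq_perm.
      - by rewrite map_inj_uniq // /index_enum -enumT enum_uniq.
      - by rewrite filter_uniq // /index_enum -enumT enum_uniq.
      by move=> a; rewrite mem_filter mem_index_enum andbT codomE /index_enum -enumT.
    by rewrite !im //; apply: eq_bigl => a; rewrite (eqP (eqc a)).
  by apply: eq_bigr => s _; rewrite !perm mulrC tensor_phase_sqr mulrC tensor_phase_sqr.
rewrite negb_forall => /existsP[z zc].
suff z0 b1 : \sum_s conjc (tensor_power m (phase_state b1 s) c)
                * tensor_power m (phase_state b1 s) c' = 0 by rewrite !z0.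
set S := \sum_s _; apply/eqP; suff : S == - S by rewrite eq_sym eqNr.
rewrite {1}/S (reindex_inj (inv_inj (flipK z))) /= /S -sumrN; apply/eqP.
apply: eq_bigr => s _; rewrite !tensor_phase_flip // rmorphM /= conj_sign.
by move: zc; case: (z \in codom c); case: (z \in codom c') => //= _;
   rewrite ?expr0 ?expr1; ring.
Qed.

Lemma avg_outcome_inj_indep (O : finType) (E : O -> op R (copies_basis m n)) b o :
  \sum_s outcome_dist E (inj_part (tensor_power m (phase_state b s))) o
  = \sum_s outcome_dist E (inj_part (tensor_power m (phase_state (zerob n) s))) o.
Proof.
have H b1 : \sum_s outcome_dist E (inj_part (tensor_power m (phase_state b1 s))) o
  = complex.Re (\sum_(c : copies_basis m n) \sum_(c' : copies_basis m n)
                   (injectiveb c)%:R * (injectiveb c')%:R * E o c c'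
                   * avg_inj_moment c c' b1).
  rewrite -Re_sum exchange_big; congr complex.Re; apply: eq_bigr => c _.
  rewrite exchange_big; apply: eq_bigr => c' _; rewrite mulr_sumr.
  by apply: eq_bigr => s _; rewrite /inj_part rmorphM /= conjc_nat; ring.
rewrite !H; congr complex.Re; apply: eq_bigr => c _; apply: eq_bigr => c' _.
case: (boolP (injectiveb c)) => [/injectiveP ic|]; last by rewrite !mul0r.
case: (boolP (injectiveb c')) => [/injectiveP ic'|]; last by rewrite mulr0 !mul0r.
by rewrite avg_inj_moment_indep.
Qed.

(* The Pauli strings, diagonal ones excluded, that commute with the antiunitary
   fixing [phase_state b s]. *)
Definition sym_event b (x : plabel n) : bool :=
  (xpart n x != zerob n)
  && ~~ odd (dotb n (xpart n x) (zpart n x) + dotb n (xpart n x) b).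

(** The labels with [v = 0] carry the collision probability [1 / d] of the uniform distribution on
    [T]; those of wrong parity carry nothing by [corr_eq0]. *)
Lemma sym_event_prob b s :
  \sum_(x | sym_event b x) pauli_dist (density (phase_state b s)) x = 1 - d^-1.
Proof.
have pure := phase_state_pure b s.
have := sum_pauli_dist n _ pure; rewrite sum_label (bigD1 (zerob n)) //=.
have -> : \sum_w pauli_dist (density (phase_state b s)) (mk_label n (zerob n) w) = d^-1.
  transitivity (\sum_a (a \in T)%:R / d * d^-1); last first.
    by rewrite -mulr_suml sum_support mul1r.
  rewrite sum_pauli_dist_z // Re_sum.
  apply: eq_bigr => a _; rewrite shift0 !phase_state_sqr -rmorphM /=.
  by case: (a \in T); rewrite /= ?mul1r ?mul0r.
move/(canRL (addKr _)) => tot; rewrite [1 - _]addrC -tot.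
rewrite big_mkcond sum_label (bigD1 (zerob n)) //=.
rewrite big1 ?add0r => [|w _]; last by rewrite /sym_event xpart_mk eqxx.
apply: eq_bigr => v v0; apply: eq_bigr => w _.
rewrite /sym_event xpart_mk zpart_mk v0 /=; case: ifPn => // /negPn ovw.
by rewrite pauli_distE // (corr_eq0 n _ b) ?mul0r ?mulr0 //; apply: conj_phase_state.
Qed.

(** Write the parity indicator as [(1 + (-1)^k) / 2]; for [v] nonzero the sign sums to zero over
    [b]. *)
Lemma sym_event_half (x : plabel n) :
  \sum_b (sym_event b x)%:R <= 2 ^+ n / 2 :> R.
Proof.
rewrite /sym_event; move: (xpart n x) (zpart n x) => v w.
case: (boolP (v == zerob n)) => v0 /=.
  by rewrite big1 // divr_ge0 ?exprn_ge0.
have half k : (~~ odd k)%:R = (1 + (-1) ^+ k) / 2 :> R.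
  by rewrite -signr_odd; case: (odd k); rewrite ?expr0 ?expr1 /=; lra.
under eq_bigr do rewrite half exprD.
rewrite -mulr_suml big_split /= -mulr_sumr sum_sign_dotb (negbTE v0) mul0r mulr0.
by rewrite addr0 sumr_const card_ffun card_bool card_ord natrX.
Qed.

(** * Averaging over [b] and [s] for a fixed measurement *)

Section Sampler.
Variables (E : plabel n -> op R (copies_basis m n)).
Hypothesis povmE : is_povm E.
Local Notation Psi b s := (tensor_power m (phase_state b s)).
Local Notation nS := (#|{ffun qbasis n -> bool}|%:R : R).

Lemma outcome_dist_split (u : copies_basis m n -> C) x :
  outcome_dist E u x
  <= 5 / 4 * outcome_dist E (inj_part u) x + 5 * outcome_dist E (coll_part u) x.
Proof.
apply: le_trans (psd_qform_add _ (E x) _ _ (povmE.1 x)).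
rewrite le_eqVlt; apply/orP; left; apply/eqP; congr complex.Re.
have split_u c : inj_part u c + coll_part u c = u c.
  by rewrite /inj_part /coll_part; case: (injectiveb c);
     rewrite /= ?mul1r ?mul0r ?addr0 ?add0r.
by apply: eq_bigr => c _; apply: eq_bigr => c' _; rewrite !split_u.
Qed.

Lemma sum_outcome_coll b s :
  \sum_x outcome_dist E (coll_part (Psi b s)) x <= m%:R ^+ 2 / d.
Proof.
apply: le_trans collision_weight; rewrite sum_outcome_dist // Re_sum [leRHS]big_mkcond /=.
apply: ler_sum => c _; rewrite /coll_part; case: (injectiveb c) => /=.
  by rewrite !mul0r.
by rewrite !mul1r tensor_phase_sqr.
Qed.

Lemma sum_outcome_inj b s :
  \sum_x outcome_dist E (inj_part (Psi b s)) x <= 1.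
Proof.
rewrite sum_outcome_dist // -sum_tensor_weight Re_sum.
apply: ler_sum => c _; rewrite /inj_part; case: (injectiveb c) => /=.
  by rewrite !mul1r tensor_phase_sqr.
by rewrite !mul0r; apply: prodr_ge0 => k _; rewrite divr_ge0.
Qed.

(** The collision-free part contributes [5/4 * 1/2 = 5/8]: its averaged weight [W] is the same for
    all [b], so each label can be averaged over [b] separately. The colliding part is bounded by its
    whole weight. *)
Lemma avg_sym_event_outcome :
  \sum_b \sum_s \sum_(x | sym_event b x) outcome_dist E (Psi b s) x
  <= (5 / 8 + 5 * (m%:R ^+ 2 / d)) * (2 ^+ n * nS).
Proof.
pose W x := \sum_s outcome_dist E (inj_part (Psi (zerob n) s)) x.
have W0 x : 0 <= W x by apply: sumr_ge0 => s _; apply: outcome_dist_ge0.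
have card_b : \sum_(b : qbasis n) 1 = 2 ^+ n :> R.
  by rewrite sumr_const card_qbasis natrX.
have hW : \sum_b \sum_(x | sym_event b x) W x <= 2 ^+ n / 2 * nS.
  under eq_bigr do rewrite big_mkcond.
  rewrite exchange_big /=.
  apply: (@le_trans _ _ (\sum_x 2 ^+ n / 2 * W x)).
    apply: ler_sum => x _.
    rewrite (eq_bigr (fun b => (sym_event b x)%:R * W x)); last first.
      by move=> b _; case: ifP; rewrite ?mul1r ?mul0r.
    by rewrite -mulr_suml ler_wpM2r // sym_event_half.
  rewrite -mulr_sumr ler_wpM2l ?divr_ge0 ?exprn_ge0 // exchange_big /=.
  by rewrite -sumr_const; apply: ler_sum => s _; apply: sum_outcome_inj.
apply: (@le_trans _ _ (\sum_b (5 / 4 * \sum_(x | sym_event b x) W x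
                               + 5 * (nS * (m%:R ^+ 2 / d))))); last first.
  rewrite big_split /= -mulr_sumr.
  have -> : \sum_(b : qbasis n) 5 * (nS * (m%:R ^+ 2 / d))
            = 2 ^+ n * (5 * (nS * (m%:R ^+ 2 / d))).
    by rewrite -card_b mulr_suml; apply: eq_bigr => b _; rewrite mul1r.
  lra.
apply: ler_sum => b _.
apply: (@le_trans _ _ (\sum_s \sum_(x | sym_event b x)
    (5 / 4 * outcome_dist E (inj_part (Psi b s)) x
     + 5 * outcome_dist E (coll_part (Psi b s)) x))).
  by apply: ler_sum => s _; apply: ler_sum => x _; apply: outcome_dist_split.
under eq_bigr do rewrite big_split /= -!mulr_sumr.
rewrite big_split /= -!mulr_sumr; apply: lerD.
  rewrite ler_pM2l ?divr_gt0 // exchange_big /=.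
  by apply: ler_sum => x _; rewrite avg_outcome_inj_indep.
rewrite ler_pM2l // -sumr_const mulr_suml; apply: ler_sum => s _; rewrite mul1r.
apply: le_trans (sum_outcome_coll b s); rewrite big_mkcond.
by apply: ler_sum => x _; case: ifP => // _; apply: outcome_dist_ge0.
Qed.

(** If every distance were at most 1/3, averaging would give [2/3 - 1/d <= 5/8 + 5 m^2 / d], that is
    [d <= 120 m^2 + 24]. *)
Lemma exists_hard_phase_state : (120 * m ^ 2 + 24 < #|T|)%N ->
  exists b s, tv_dist (pauli_dist (density (phase_state b s)))
                      (outcome_dist E (Psi b s)) > 3^-1.
Proof.
move=> dm.
suff /existsP[b /existsP[s h]] : [exists b, exists s,
   3^-1 < tv_dist (pauli_dist (density (phase_state b s))) (outcome_dist E (Psi b s))].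
  by exists b, s.
apply: contraT; rewrite negb_exists => /forallP H; exfalso.
have lower b s : 1 - d^-1 - 3^-1 <= \sum_(x | sym_event b x) outcome_dist E (Psi b s) x.
  have := H b; rewrite negb_exists => /forallP/(_ s); rewrite -leNgt => tv.
  have := @tv_dist_event _ _ _ (outcome_dist E (Psi b s)) (sym_event b)
     (sum_pauli_dist n _ (phase_state_pure b s)).
  rewrite sum_outcome_dist // tensor_phase_pure => /(_ erefl).
  rewrite sym_event_prob; move: tv; lra.
have : (1 - d^-1 - 3^-1) * (2 ^+ n * nS)
       <= (5 / 8 + 5 * (m%:R ^+ 2 / d)) * (2 ^+ n * nS).
  apply: le_trans avg_sym_event_outcome.
  have -> : (1 - d^-1 - 3^-1) * (2 ^+ n * nS)
     = \sum_(b : qbasis n) \sum_(s : {ffun qbasis n -> bool}) (1 - d^-1 - 3^-1).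
    rewrite !sumr_const -mulrnA -[RHS]mulr_natr natrM; congr (_ * _).
    by rewrite card_qbasis natrX mulrC.
  by apply: ler_sum => b _; apply: ler_sum => s _; apply: lower.
have d0 : 0 < d by rewrite ltr0n.
rewrite ler_pM2r; last first.
  rewrite mulr_gt0 ?exprn_gt0 // ltr0n; apply/card_gt0P.
  by exists [ffun=> false].
move=> le1; have : (1 - d^-1 - 3^-1) * d <= (5 / 8 + 5 * (m%:R ^+ 2 / d)) * d.
  by rewrite ler_pM2r.
have : 120 * m%:R ^+ 2 + 24 < d by rewrite -natrX -natrM -natrD ltr_nat.
have -> : m%:R ^+ 2 = m%:R ^+ 2 / d * d by rewrite divfK ?gt_eqF.
have : d^-1 * d = 1 by rewrite mulVf ?gt_eqF.
rewrite mulfK ?gt_eqF //; move: (d^-1) (m%:R ^+ 2 / d) => i e; lra.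
Qed.

End Sampler.

(** A nonzero term of [corr] needs both [a] and [a + v] in [T], and then their sum [v] is in [T]. *)
Lemma xpart_in_support b s (x : plabel n) :
  (forall a a', a \in T -> a' \in T -> shift n a a' \in T) ->
  pauli_dist (density (phase_state b s)) x != 0 -> xpart n x \in T.
Proof.
move=> Tgroup; apply: contraNT => xT; rewrite -(mk_label_parts n x) pauli_distE; last first.
  exact: phase_state_pure.
rewrite /corr big1 ?mul0r ?mulr0 // => a _.
have [aT|/negbTE aT] := boolP (a \in T); last by rewrite /phase_state aT !mul0r.
have [avT|/negbTE avT] := boolP (shift n a (xpart n x) \in T).
  case/negP: xT; have := Tgroup _ _ avT aT.
  by rewrite (shiftC n a) shiftK.
by rewrite [X in conjc X]/phase_state avT !mul0r conjc0 mulr0 mul0r.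
Qed.

(** The support has at most [d * 2^n] labels, [d] choices of [v] times all [w]; the [- n] in the
    definition removes the second factor. *)
Lemma stab_entropy_phase_state (alpha : R) b s :
  (forall a a', a \in T -> a' \in T -> shift n a a' \in T) -> 0 <= alpha ->
  stab_entropy alpha (phase_state b s) <= log2 d.
Proof.
move=> Tgroup alpha0; rewrite /stab_entropy lerBlDr.
have pure := phase_state_pure b s.
have -> : log2 d + n%:R = log2 (#|T| * 2 ^ n)%:R.
  rewrite natrM natrX /log2 lnM ?posrE ?ltr0n ?exprn_gt0 //.
  by rewrite mulrDl; congr (_ + _); have := log2_pow2 R n; rewrite /log2.
apply: renyi_seq_le_log_supp => //.
- by move=> p /mapP[x _ ->]; apply: pauli_dist_ge0.
- by rewrite big_map big_enum /= sum_pauli_dist.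
rewrite count_map; set P := preim _ _.
have -> : count P (enum {: plabel n}) = #|[set x | P x]|.
  by rewrite -sum1_count big_enum_cond -sum1_card; apply: eq_bigl => x; rewrite inE.
have inj : injective (fun x : plabel n => (xpart n x, zpart n x)).
  by apply: (can_inj (g := fun p => mk_label n p.1 p.2)) => x; apply: mk_label_parts.
rewrite -card_qbasis -cardsT -cardsX -(card_imset _ inj).
apply/subset_leq_card/subsetP => _ /imsetP[x + ->]; rewrite !inE andbT /P /= => px.
exact: xpart_in_support px.
Qed.

End PhaseStates.

(** * Choice of the support and of the number of qubits *)

Definition subcube (n k : nat) : {set qbasis n} :=
  [set a : qbasis n | [forall j : 'I_n, (k <= j)%N ==> ~~ a j]].

Lemma card_subcube (n k : nat) : (k <= n)%N -> #|subcube n k| = (2 ^ k)%N.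
Proof.
move=> kn; transitivity (\sum_(a : qbasis n) \prod_(j < n) ((k <= j) ==> ~~ a j))%N.
  rewrite -sum1_card big_mkcond; apply: eq_bigr => a _; rewrite inE.
  case: ifPn => [/forallP h|].
    by rewrite big1 // => j _; rewrite (h j).
  rewrite negb_forall => /existsP[j hj].
  by rewrite (bigD1 j) //= (negbTE hj) mul0n.
rewrite -(bigA_distr_bigA (fun (j : 'I_n) e => ((k <= j) ==> ~~ e : nat)%N)) /=.
rewrite (eq_bigr (fun j : 'I_n => if (j < k)%N then 2%N else 1%N)).
  by rewrite -big_mkcond -(big_ord_widen _ (fun=> 2%N)) // prod_nat_const card_ord.
by move=> j _; rewrite big_bool /= implybF implybT ltnNge; case: (k <= j)%N.
Qed.

Lemma subcube_shift (n k : nat) (a a' : qbasis n) :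
  a \in subcube n k -> a' \in subcube n k -> shift n a a' \in subcube n k.
Proof.
rewrite !inE => /forallP h /forallP h'; apply/forallP => j; apply/implyP => kj.
by rewrite ffunE (negbTE (implyP (h j) kj)) (negbTE (implyP (h' j) kj)).
Qed.

Lemma sqrn_le_exp2 (j : nat) : (4 <= j)%N -> (j ^ 2 <= 2 ^ j)%N.
Proof.
elim: j => // j IH; rewrite leq_eqVlt => /orP[/eqP <- //|j4].
have := IH j4; rewrite [(2 ^ j.+1)%N]expnS; nia.
Qed.

(** With [M = 2^c * 2^(j e)] one has [x <= 2 M], and [480 M^2 + 24 < 1024 M^2]. *)
Lemma poly_lt_exp2 (c e j x : nat) : (x <= c * (2 ^ j) ^ e + c)%N ->
  (120 * x ^ 2 + 24 < 2 ^ (10 + 2 * c + 2 * (j * e)))%N.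
Proof.
move=> hx.
have hM : (x <= 2 * (2 ^ c * 2 ^ (j * e)))%N.
  apply: leq_trans hx _; rewrite -expnM.
  have := ltn_expl c (isT : (1 < 2)%N); have : (0 < 2 ^ (j * e))%N by rewrite expn_gt0.
  nia.
have -> : (2 ^ (10 + 2 * c + 2 * (j * e)) = 1024 * (2 ^ c * 2 ^ (j * e)) ^ 2)%N.
  have -> : (10 + 2 * c + 2 * (j * e) = 10 + (c + j * e) * 2)%N by lia.
  by rewrite expnD [(2 ^ (_ * 2))%N]expnM expnD.
have : (0 < 2 ^ c * 2 ^ (j * e))%N by rewrite muln_gt0 !expn_gt0.
move: (2 ^ c * 2 ^ (j * e))%N hM => M hM; nia.
Qed.

Lemma low_complexity_hard_states (R : realType) (f g : nat -> R) (alpha : R) :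
  little_omega_log f -> little_omega_log g -> 0 <= alpha ->
  forall (m : nat -> nat), poly_bounded m ->
  forall E : forall n : nat, plabel n -> op R (copies_basis (m n) n),
  (forall n, is_povm (E n)) ->
  exists (n : nat) (psi : qbasis n -> R[i]),
    is_pure_state psi /\
    stab_entropy alpha psi < g n /\
    (forall A : {set 'I_n}, A != set0 -> A != setT ->
       ent_entropy_lt alpha psi A (f n)) /\
    tv_dist (pauli_dist (density psi))
            (outcome_dist (E n) (tensor_power (m n) psi)) > 3^-1.
Proof.
move=> fw gw alpha0 m [c [e mb]] E povmE.
have l2 : 0 < ln (2 : R) by rewrite ln_gt0 ?ltr1n.
(* Chosen so that [k <= A * j] below; with [n = 2^j], [A / ln 2 * ln n] is exactly [A * j]. *)
pose A := (10 + 2 * c + 2 * e)%N.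
have K0 : 0 < A%:R / ln 2 :> R by rewrite divr_gt0 ?ltr0n.
have [N1 hN1] := fw _ K0; have [N2 hN2] := gw _ K0.
(* The 4 gives [j^2 <= 2^j], the [A] then gives [k <= A * j <= j^2 <= n], and [N1], [N2] put [n]
   past both thresholds. *)
pose j := (4 + A + N1 + N2)%N; pose n := (2 ^ j)%N.
have jn : (j < n)%N by apply: ltn_expl.
pose k := (10 + 2 * c + 2 * (j * e))%N.
have kA : (k <= A * j)%N by rewrite /k /A /j; nia.
have kn : (k <= n)%N.
  apply: leq_trans (_ : (j ^ 2 <= _)%N); last by apply: sqrn_le_exp2.
  by apply: leq_trans kA _; rewrite expnS expn1 leq_mul2r /j; apply/orP; right; lia.
have cT := card_subcube _ _ kn.
have T_gt0 : (0 < #|subcube n k|)%N by rewrite cT expn_gt0.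
have logT : log2 #|subcube n k|%:R = k%:R :> R by rewrite cT natrX log2_pow2.
have klt (h : nat -> R) N : (N <= j)%N ->
    (forall n : nat, (N <= n)%N -> A%:R / ln 2 * ln n%:R < h n) -> k%:R < h n.
  move=> Nj /(_ n) hn; apply: le_lt_trans (hn _); last by apply: leq_trans Nj (ltnW jn).
  rewrite /n natrX lnXn // -[ln _ *+ j]mulr_natl mulrCA divfK ?gt_eqF //.
  by rewrite mulrC -natrM ler_nat.
have mT : (120 * m n ^ 2 + 24 < #|subcube n k|)%N by rewrite cT; apply: poly_lt_exp2.
have [b [s tv]] := exists_hard_phase_state n (m n) _ T_gt0 _ (povmE n) mT.
have pure := phase_state_pure n _ T_gt0 b s.
exists n, (phase_state n (subcube n k) b s); split; [|split; [|split]] => //.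
- apply: le_lt_trans (klt g N2 _ hN2); last by rewrite /j; lia.
  by rewrite -logT; apply: stab_entropy_phase_state => // a a'; apply: subcube_shift.
move=> S _ _; apply: (ent_entropy_lt_supp _ _ _ _ (subcube n k)) => //.
  by move=> a /negbTE aT; rewrite /phase_state aT !mul0r.
by rewrite logT; apply: klt hN1; rewrite /j; lia.
Qed.

Theorem theorem5 (R : realType) (f g : nat -> R) (alpha : R) :
  little_omega_log f -> little_omega_log g -> 0 <= alpha ->
  (* (1) no poly-copy algorithm samples the Pauli distribution for all states *)
  (forall (m : nat -> nat), poly_bounded m ->
   forall E : forall n : nat, plabel n -> op R (copies_basis (m n) n),
   (forall n, is_povm (E n)) ->
   exists (n : nat) (psi : qbasis n -> R[i]),
     is_pure_state psi /\
     tv_dist (pauli_dist (density psi))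
             (outcome_dist (E n) (tensor_power (m n) psi)) > 3^-1)
  /\
  (* (2) ... even under the promise of low magic and low entanglement *)
  (forall (m : nat -> nat), poly_bounded m ->
   forall E : forall n : nat, plabel n -> op R (copies_basis (m n) n),
   (forall n, is_povm (E n)) ->
   exists (n : nat) (psi : qbasis n -> R[i]),
     is_pure_state psi /\
     stab_entropy alpha psi < g n /\
     (forall A : {set 'I_n}, A != set0 -> A != setT ->
        ent_entropy_lt alpha psi A (f n)) /\
     tv_dist (pauli_dist (density psi))
             (outcome_dist (E n) (tensor_power (m n) psi)) > 3^-1).
Proof.
move=> fw gw alpha0; have hard := low_complexity_hard_states _ f g alpha fw gw alpha0.
split=> // m mb E povmE.
by have [n [psi [pure [_ [_ tv]]]]] := hard m mb E povmE; exists n, psi.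
Qed.
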